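(* Assume: (A1) $f(x,y)$ and each component of $g(x,y)$ are convex in $y$ for each fixed $x$, and $f,g$ are twice continuously differentiable; (A2) $Y\subseteq\mathbb{R}^m$ is a compact convex set with $\{y:\exists x\in X \text{ such that } g(x,y)\le 0\}\subseteq\mathrm{int}(Y)$; (A3) $F$ and $G$ are twice continuously differentiable; (R1) for each $x\in X$ there exists $y$ with $g(x,y)<0$; (R2) $X$ is compact and nonempty, and the constraint set $\{x:G(x)\le0\}$ satisfies MFCQ at each $x\in X$. If $\epsilon>0$ and $\mu\ge0$, then the constraint set $\mathcal{C}(\epsilon,\mu)$ of $\mathsf{DBP}(\epsilon,\mu)$ satisfies MFCQ at every point of $\mathcal{C}(\epsilon,\mu)$.
   Context: Let $F:\mathbb{R}^n\times\mathbb{R}^m\to\mathbb{R}$, $f:\mathbb{R}^n\times\mathbb{R}^m\to\mathbb{R}$, $g:\mathbb{R}^n\times\mathbb{R}^m\to\mathbb{R}^p$, $G:\mathbb{R}^n\to\mathbb{R}^q$; vector inequalities componentwise; $X=\{x:G(x)\le0\}$. For $\mu\ge0$, $h_\mu(\lambda,x)=\min_y\{\mu\|y\|^2+f(x,y)+\lambda^{\mathsf T}g(x,y):y\in Y\}$ with $Y$ from (A2). $\mathcal{C}(\epsilon,\mu)$ is the set of $(x,y,\lambda)$ satisfying the constraints $G(x)\le0$, $g(x,y)-\epsilon\le0$, $-\lambda\le0$, and $f(x,y)-h_\mu(\lambda,x)-\epsilon\le0$; $\mathsf{DBP}(\epsilon,\mu)$ is: minimize $F(x,y)$ over $\mathcal{C}(\epsilon,\mu)$.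 A constraint set $\{z:c_i(z)\le0,\ i=1,\dots,r\}$ satisfies MFCQ at a feasible $\overline{z}$ if, with $I=\{i:c_i(\overline{z})=0\}$, there exists a direction $d$ such that $v_i^{\mathsf T}d<0$ for all $i\in I$ and all choices $v_i\in\partial c_i(\overline{z})$, where $\partial$ is the (limiting) subgradient of variational analysis (equal to $\{\nabla c_i(\overline{z})\}$ for continuously differentiable $c_i$). *)

(* Defs.v *)
From HB Require Import structures.
From mathcomp Require Import all_boot all_order all_algebra.
From mathcomp Require Import all_classical all_reals all_analysis.
Set Implicit Arguments. Unset Strict Implicit. Unset Printing Implicit Defensive.
Import Order.TTheory GRing.Theory Num.Theory.
Import numFieldNormedType.Exports.
Local Open Scope classical_set_scope.
Local Open Scope ring_scope.

Section Defs.
Variable R : realType.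

Definition dotv (N : nat) (u v : 'rV[R]_N) : R := \sum_(i < N) u 0 i * v 0 i.
Definition sqnorm (N : nat) (u : 'rV[R]_N) : R := dotv u u.

Definition evec (N : nat) (i : 'I_N) : 'rV[R]_N := delta_mx 0 i.

Definition partial (N : nat) (W : normedModType R) (h : 'rV[R]_N -> W)
  (i : 'I_N) (z : 'rV[R]_N) : W := 'd h z (evec i).
Definition grad (N : nat) (h : 'rV[R]_N -> R) (z : 'rV[R]_N) : 'rV[R]_N :=
  \row_i partial h i z.

Definition C1 (N : nat) (W : normedModType R) (h : 'rV[R]_N -> W) : Prop :=
  (forall z, differentiable h z) /\ (forall i, continuous (partial h i)).
Definition C2 (N : nat) (h : 'rV[R]_N -> R) : Prop := C1 h /\ C1 (grad h).
Definition C2vec (N K : nat) (h : 'rV[R]_N -> 'rV[R]_K) : Prop :=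
  forall j : 'I_K, C2 (fun z => h z 0 j).
Definition C2_2 (n m : nat) (h : 'rV[R]_n -> 'rV[R]_m -> R) : Prop :=
  C2 (fun z : 'rV[R]_(n + m) => h (lsubmx z) (rsubmx z)).
Definition C2vec_2 (n m K : nat) (h : 'rV[R]_n -> 'rV[R]_m -> 'rV[R]_K) : Prop :=
  C2vec (fun z : 'rV[R]_(n + m) => h (lsubmx z) (rsubmx z)).

Definition convex_set_rV (N : nat) (Y : set 'rV[R]_N) : Prop :=
  forall a b, Y a -> Y b -> forall t : R, 0 <= t <= 1 ->
    Y (t *: a + (1 - t) *: b).
Definition convex_fun_rV (N : nat) (h : 'rV[R]_N -> R) : Prop :=
  forall a b (t : R), 0 <= t <= 1 ->
    h (t *: a + (1 - t) *: b) <= t * h a + (1 - t) * h b.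

Definition vle0 (K : nat) (u : 'rV[R]_K) : Prop := forall j, u 0 j <= 0.
Definition vlt0 (K : nat) (u : 'rV[R]_K) : Prop := forall j, u 0 j < 0.

Definition frechet_subgrad (N : nat) (c : 'rV[R]_N -> R) (z v : 'rV[R]_N) : Prop :=
  forall e : R, 0 < e -> exists2 d : R, 0 < d & forall z' : 'rV[R]_N,
    `|z' - z| < d -> c z + dotv v (z' - z) - e * `|z' - z| <= c z'.

Definition limiting_subgrad (N : nat) (c : 'rV[R]_N -> R) (z v : 'rV[R]_N) : Prop :=
  exists (zk vk : nat -> 'rV[R]_N),
    [/\ zk @ \oo --> z, (fun k => c (zk k)) @ \oo --> c z,
        vk @ \oo --> v & forall k, frechet_subgrad c (zk k) (vk k)].

(* MFCQ for the constraint system {z : c i z <= 0, i in I} at a feasible zbar *)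
Definition MFCQ (I : finType) (N : nat) (c : I -> 'rV[R]_N -> R) (zbar : 'rV[R]_N) : Prop :=
  exists d : 'rV[R]_N, forall i : I, c i zbar = 0 ->
    forall v, limiting_subgrad (c i) zbar v -> dotv v d < 0.

Definition hmu (n m p : nat) (f : 'rV[R]_n -> 'rV[R]_m -> R)
  (g : 'rV[R]_n -> 'rV[R]_m -> 'rV[R]_p) (Y : set 'rV[R]_m) (mu : R)
  (lam : 'rV[R]_p) (x : 'rV[R]_n) : R :=
  inf [set mu * sqnorm y + f x y + dotv lam (g x y) | y in Y].

Definition zx (n m p : nat) (z : 'rV[R]_(n + m + p)) : 'rV[R]_n := lsubmx (lsubmx z).
Definition zy (n m p : nat) (z : 'rV[R]_(n + m + p)) : 'rV[R]_m := rsubmx (lsubmx z).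
Definition zl (n m p : nat) (z : 'rV[R]_(n + m + p)) : 'rV[R]_p := rsubmx z.

Definition DBP_constr (n m p q : nat) (f : 'rV[R]_n -> 'rV[R]_m -> R)
  (g : 'rV[R]_n -> 'rV[R]_m -> 'rV[R]_p) (G : 'rV[R]_n -> 'rV[R]_q)
  (Y : set 'rV[R]_m) (eps mu : R)
  (i : ('I_q + 'I_p + 'I_p + unit)%type) (z : 'rV[R]_(n + m + p)) : R :=
  match i with
  | inl (inl (inl k)) => G (zx z) 0 k
  | inl (inl (inr j)) => g (zx z) (zy z) 0 j - eps
  | inl (inr j) => - (zl z 0 j)
  | inr _ => f (zx z) (zy z) - hmu f g Y mu (zl z) (zx z) - eps
  end.

Definition DBP_feas (n m p q : nat) f g G Y (eps mu : R) : set 'rV[R]_(n + m + p) :=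
  [set z | forall i, @DBP_constr n m p q f g G Y eps mu i z <= 0].

End Defs.

(* Main.v *)
(**
No subdifferential calculus is needed: if [c (z + t d) <= c z + t a] for every
[z] close to [zbar] and every small [t > 0], then testing the Frechet
inequality along [d] gives [v . d <= a] for every limiting subgradient [v] of
[c] at [zbar].

Let [x, y, lam] be the components of [zbar].  Let [y'] minimize
[mu |y|^2 + f x y] subject to [g x y <= 0], and let [lam' > 0] be (slightly
enlarged) multipliers read off a minimizer of a quadratic penalization of that
problem; then [f x y' <= h_mu lam' x + eps/2].  The direction is
[(s dG, y' - y, lam' - lam)] with [dG] an MFCQ direction for [G] at [x] and
[s > 0] small.  By convexity of [f], [g] in [y] and concavity of [h_mu] in
[lam], moving along [(y' - y, lam' - lam)] decreases each active constraint
relaxed by [eps] at rate at least [eps/2], and the move [s dG] in [x] spoils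
this only by a Lipschitz constant times [s].
*)
Require Import Defs.
From HB Require Import structures.
From mathcomp Require Import all_boot all_order all_algebra.
From mathcomp Require Import all_classical all_reals all_analysis.
From mathcomp Require Import ring lra.
Import Order.TTheory GRing.Theory Num.Theory.
Import numFieldNormedType.Exports.
Local Open Scope classical_set_scope.
Local Open Scope ring_scope.

(** * Directional bounds and limiting subgradients *)

Section Slope.
Set Implicit Arguments. Unset Strict Implicit.
Variable R : realType.

(* Unlike in a Clarke derivative, the range of admissible [t] may depend on the base point [z]. *)
Definition slope_le (E : normedModType R) (c : E -> R) (z0 d : E) (a : R) :=
  \forall z \near z0, \forall t \near 0^'+, c (z + t *: d) <= c z + t * a.

Lemma slope_leD (E : normedModType R) (c1 c2 : E -> R) (z0 d : E) (a1 a2 : R) :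
  slope_le c1 z0 d a1 -> slope_le c2 z0 d a2 ->
  slope_le (fun z => c1 z + c2 z) z0 d (a1 + a2).
Proof.
move=> s1 s2; near=> z.
have z1 : \forall t \near 0^'+, c1 (z + t *: d) <= c1 z + t * a1 by near: z.
have z2 : \forall t \near 0^'+, c2 (z + t *: d) <= c2 z + t * a2 by near: z.
near=> t; rewrite mulrDr addrACA lerD //; first by near: t.
by near: t.
Unshelve. all: by end_near. Qed.

Lemma slope_le_comp (E E' : normedModType R) (l : E -> E') (c : E' -> R)
    (z0 d : E) (a : R) :
  {for z0, continuous l} -> (forall z t, l (z + t *: d) = l z + t *: l d) ->
  slope_le c (l z0) (l d) a -> slope_le (c \o l) z0 d a.
Proof.
move=> lc ll /lc /= s; near=> z.
have z1 : \forall t \near 0^'+, c (l z + t *: l d) <= c (l z) + t * a by near: z.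
by near=> t; rewrite /= ll; near: t.
Unshelve. all: by end_near. Qed.

Lemma dotvZr (N : nat) (v d : 'rV[R]_N) (t : R) : dotv v (t *: d) = t * dotv v d.
Proof. by rewrite /dotv mulr_sumr; apply: eq_bigr => i _; rewrite mxE mulrCA. Qed.

Lemma cvg_dotv (N : nat) (T : Type) (F : set_system T) {FF : Filter F}
    (u v : T -> 'rV[R]_N) (a b : 'rV[R]_N) :
  u @ F --> a -> v @ F --> b -> (fun t => dotv (u t) (v t)) @ F --> dotv a b.
Proof.
move=> ua vb; rewrite /dotv; apply: cvg_big => [|i _]; first exact: add_continuous.
apply: cvgM.
  exact: (cvg_comp _ _ ua (@coord_continuous _ _ _ _ _ a)).
exact: (cvg_comp _ _ vb (@coord_continuous _ _ _ _ _ b)).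
Qed.

(** Testing the Frechet inequality at [z + t *: d] bounds [t * dotv v d] by [t * a] plus an
    arbitrarily small multiple of [t]; then divide by [t]. *)
Lemma frechet_subgrad_slope (N : nat) (c : 'rV[R]_N -> R) (z v d : 'rV[R]_N) (a : R) :
  (\forall t \near 0^'+, c (z + t *: d) <= c z + t * a) ->
  frechet_subgrad c z v -> dotv v d <= a.
Proof.
move=> s fv; apply/ler_addgt0Pr => e e0.
have d1 : 0 < `|d| + 1 by rewrite ltr_wpDl.
have [r r0 rP] := fv (e / (`|d| + 1)) (divr_gt0 e0 d1).
near (0 : R)^'+ => t.
have t0 : 0 < t by near: t; exact: nbhs_right_gt.
have st : c (z + t *: d) <= c z + t * a by near: t.
have := rP (z + t *: d); rewrite addrAC subrr add0r normrZ gtr0_norm // => /(_ _)/wrap[].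
  rewrite (@le_lt_trans _ _ (t * (`|d| + 1))) // ?ler_pM2l ?lerDl //.
  by rewrite -ltr_pdivlMr //; near: t; apply: nbhs_right_lt; rewrite divr_gt0.
move=> /le_trans /(_ st); rewrite dotvZr => H.
have ed : e / (`|d| + 1) * `|d| <= e.
  by rewrite mulrAC ler_pdivrMr // ler_pM2l // lerDl.
rewrite -(ler_pM2l t0) mulrDr.
have : t * (e / (`|d| + 1) * `|d|) <= t * e by rewrite ler_pM2l.
move: H; set A := e / _; set B := `|d|; set D := dotv _ _; lra.
Unshelve. all: by end_near. Qed.

(** For large [k] the vector [vk k] obeys the Frechet bound at [zk k], because [slope_le] covers
    every base point near [z]; the bound passes to the limit. *)
Lemma limiting_subgrad_slope (N : nat) (c : 'rV[R]_N -> R) (z v d : 'rV[R]_N) (a : R) :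
  slope_le c z d a -> limiting_subgrad c z v -> dotv v d <= a.
Proof.
move=> s [zk [vk [zkz _ vkv fk]]].
have dl : (fun k => dotv (vk k) d) @ \oo --> dotv v d.
  exact: cvg_dotv vkv (cvg_cst _).
rewrite -(cvg_lim _ dl) //; apply: limr_le; first by apply/cvg_ex; exists (dotv v d).
near=> k; apply: frechet_subgrad_slope (fk k); near: k.
exact: (zkz _ s).
Unshelve. all: by end_near. Qed.

Lemma diff_partialE (N : nat) (c : 'rV[R]_N -> R) (z w : 'rV[R]_N) :
  differentiable c z -> 'd c z w = \sum_i w 0 i * partial c i z.
Proof.
move=> dc; rewrite [in LHS](row_sum_delta w) linear_sum.
by apply: eq_bigr => i _; rewrite linearZ.
Qed.

Lemma dotv_grad (N : nat) (c : 'rV[R]_N -> R) (z w : 'rV[R]_N) :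
  differentiable c z -> dotv (grad c z) w = 'd c z w.
Proof.
move=> dc; rewrite diff_partialE //.
by apply: eq_bigr => i _; rewrite mxE mulrC.
Qed.

(** Differentiability yields the Frechet inequality at [z], so constant sequences do. This turns an
    MFCQ direction into one of negative derivative. *)
Lemma limiting_subgrad_grad (N : nat) (c : 'rV[R]_N -> R) (z : 'rV[R]_N) :
  differentiable c z -> limiting_subgrad c z (grad c z).
Proof.
move=> dc; exists (fun=> z), (fun=> grad c z); split; try exact: cvg_cst.
move=> _ e e0.
have /diff_locallyP[_ /eqaddoP/(_ e e0)] := dc.
rewrite nearE => /nbhs_normP[r /= r0 rP]; exists r => // z' zr.
have := rP (z' - z); rewrite /ball_ /= sub0r normrN => /(_ zr).
rewrite !fctE /= subrK dotv_grad // ler_norml => /andP[+ _].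
set A := 'd c z _; set B := `|_|; lra.
Qed.

Lemma continuous_partial_diff (N : nat) (c : 'rV[R]_N -> R) (w : 'rV[R]_N) :
  C1 c -> continuous (fun z => 'd c z w).
Proof.
move=> [dc pc].
rewrite (_ : (fun _ => _) = fun z => \sum_i w 0 i * partial c i z); last first.
  by apply/funext => z; rewrite diff_partialE.
apply: continuous_big => [|i _ z]; first exact: add_continuous.
by apply: continuousM; [exact: cst_continuous|exact: pc].
Qed.

(** The derivative along [w] is continuous in the base point, so it stays below [a] near [z0]; at
    each such point the difference quotients are eventually below [a]. *)
Lemma C1_slope_le (N : nat) (c : 'rV[R]_N -> R) (z0 w : 'rV[R]_N) (a : R) :
  C1 c -> 'd c z0 w < a -> slope_le c z0 w a.
Proof.
move=> cC1 ca; have [dc _] := cC1; near=> z.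
have za : 'd c z w < a.
  by near: z; apply: (cvgr_lt _ _ _ ca); exact: continuous_partial_diff.
have /diff_derivable -/(_ w) := dc z.
rewrite /derivable => /cvg_ex[l] cl.
have la : l < a.
  by rewrite -(cvg_lim _ cl) // -/(derive c z w) deriveE.
have : \forall h \near 0^'+, h^-1 *: ((c \o shift z) (h *: w) - c z) < a.
  exact: (cvgr_lt _ (cvg_dnbhs_at_right cl) _ la).
move=> H; near=> t.
have t0 : 0 < t by near: t; exact: nbhs_right_gt.
have : t^-1 *: ((c \o shift z) (t *: w) - c z) < a by near: t.
rewrite /= /GRing.scale /= mulrC ltr_pdivrMr // [_ + z]addrC => H1.
by rewrite -lerBlDl ltW // mulrC.
Unshelve. all: by end_near. Qed.

End Slope.

(** * Approximate duality by penalization *)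

Section Duality.
Variable R : realType.
Set Implicit Arguments. Unset Strict Implicit.

Lemma continuous_compact_min (T : topologicalType) (A : set T) (h : T -> R) :
  A !=set0 -> compact A -> continuous h ->
  exists2 a, A a & forall b, A b -> h a <= h b.
Proof.
move=> A0 cA ch.
have [a /set_mem Aa ha] := compact_EVT_min A0 cA (@continuous_subspaceT _ _ A h ch).
by exists a => // b /mem_set; exact: ha.
Qed.

(** The squared positive part has derivative [2 * Num.max 0 a], which is 2-Lipschitz; this is the
    resulting quadratic upper bound. *)
Lemma sqr_max0_le (a s : R) :
  Num.max 0 (a + s) ^+ 2 <= Num.max 0 a ^+ 2 + 2 * Num.max 0 a * s + s ^+ 2.
Proof.
rewrite -{1}(addr0 0); case: (leP 0 a) => a0; case: (leP (0 + 0) (a + s)); nra.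
Qed.

(** Divide by [t] and let [t] tend to 0; the [t] below is chosen to make [t * B <= e]. *)
Lemma ge0_of_quadratic (A B : R) :
  (forall t, 0 < t <= 1 -> 0 <= t * A + t ^+ 2 * B) -> 0 <= A.
Proof.
move=> H; apply/ler_addgt0Pr => e e0; rewrite addrC.
pose t := Num.min 1 (e / (`|B| + 1)).
have B1 : 0 < `|B| + 1 by rewrite ltr_wpDl.
have t0 : 0 < t by rewrite lt_min ltr01 divr_gt0.
have t1 : t <= 1 by rewrite ge_min lexx.
have te : t * B <= e.
  apply: (@le_trans _ _ (t * (`|B| + 1))).
    by rewrite ler_pM2l // ler_wpDr // ler_norm.
  by rewrite -ler_pdivlMr // ge_min lexx orbT.
have := H t; rewrite t0 t1 => /(_ isT).
rewrite expr2 -mulrA -mulrDr pmulr_rge0 //; lra.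
Qed.

Section Penalty.
Variables (m p : nat) (Y : set 'rV[R]_m) (f0 : 'rV[R]_m -> R).
Variable (g : 'rV[R]_m -> 'rV[R]_p).
Hypothesis cY : compact Y.
Hypothesis vY : convex_set_rV Y.
Hypothesis cf : continuous f0.
Hypothesis vf : convex_fun_rV f0.
Hypothesis cg : forall j, continuous (fun y => g y 0 j).
Hypothesis vg : forall j, convex_fun_rV (fun y => g y 0 j).

(** Positive parts are squared so that the penalty is differentiable in the constraint values; its
    derivatives [2 * Num.max 0 (g y 0 j)] become the multipliers. *)
Definition viol (y : 'rV[R]_m) := \sum_j Num.max 0 (g y 0 j) ^+ 2.

Lemma viol_ge0 y : 0 <= viol y.
Proof. by apply: sumr_ge0 => j _; rewrite sqr_ge0. Qed.

Lemma viol_eq0 y : viol y = 0 <-> vle0 (g y).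
Proof.
split=> [/eqP|gy].
  rewrite psumr_eq0 => [/allP/= H j|j _]; last by rewrite sqr_ge0.
  have := H j (mem_index_enum _); rewrite sqrf_eq0.
  by case: (leP 0 (g y 0 j)) => [g0 /eqP->//|/ltW].
apply: big1 => j _; have := gy j.
by case: (leP 0 (g y 0 j)) => [g0 g1|]; rewrite ?expr0n //;
  rewrite (_ : g y 0 j = 0) ?expr0n //; apply/eqP; rewrite eq_le g0 g1.
Qed.

Lemma continuous_viol : continuous viol.
Proof.
apply: continuous_big => [|j _ y]; first exact: add_continuous.
apply: (@continuous_comp _ _ _ (fun y => Num.max 0 (g y 0 j)) (fun r : R => r ^+ 2)).
  apply: (@continuous_max _ _ (fun=> 0) (fun y => g y 0 j)).
    exact: cst_continuous.
  exact: cg.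
exact: exprn_continuous.
Qed.

(* First-order optimality of the penalty minimizer; by convexity it is a global inequality. *)
Lemma penalty_multiplier (r : R) (u : 'rV[R]_m) : 0 < r -> Y u ->
  (forall y, Y y -> f0 u + r * viol u <= f0 y + r * viol y) ->
  forall y, Y y ->
    f0 u <= f0 y + dotv (\row_j (2 * r * Num.max 0 (g u 0 j))) (g y).
Proof.
move=> r0 Yu umin y Yy.
pose a j := Num.max 0 (g u 0 j).
pose s j := g y 0 j - g u 0 j.
(* This suffices because [a j * s j <= a j * g y 0 j]: either [a j] vanishes or [g u 0 j] is
   nonnegative. *)
suff : 0 <= f0 y - f0 u + r * \sum_j (2 * a j * s j).
  move=> H; rewrite -subr_ge0; apply: le_trans H _.
  rewrite [leRHS]addrAC lerD2l /dotv mulr_sumr; apply: ler_sum => j _; rewrite mxE /s /a.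
  rewrite [2 * r]mulrC -!mulrA ler_pM2l // ler_pM2l //.
  by case: (leP 0 (g u 0 j)) => [g0|]; rewrite ?mul0r // ler_wpM2l // lerBlDr lerDl.
(* Compare [u] with the point [t *: y + (1 - t) *: u] of [Y] and expand the penalized objective to
   second order in [t]. *)
apply: (@ge0_of_quadratic _ (r * \sum_j s j ^+ 2)) => t /andP[t0 t1].
have := umin _ (vY Yy Yu (t := t) _); rewrite (ltW t0) t1 => /(_ isT).
have := vf y u (t := t); rewrite (ltW t0) t1 => /(_ isT) ft.
have vt : viol (t *: y + (1 - t) *: u) <=
    viol u + t * \sum_j (2 * a j * s j) + t ^+ 2 * \sum_j s j ^+ 2.
  rewrite /viol !mulr_sumr -!big_split /=; apply: ler_sum => j _.
  apply: (@le_trans _ _ (Num.max 0 (g u 0 j + t * s j) ^+ 2)).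
    have max0_ge0 (b : R) : 0 <= Num.max 0 b by rewrite le_max lexx.
    rewrite lerXn2r ?nnegrE // ge_max max0_ge0 /= le_max; apply/orP; right.
    have := vg j y u (t := t); rewrite (ltW t0) t1 => /(_ isT); rewrite /s; lra.
  apply: le_trans (sqr_max0_le _ _) _; rewrite exprMn -/(a j).
  by rewrite lerD2r lerD2l mulrCA.
have := ler_wpM2l (ltW r0) vt.
move: ft; set X := f0 (_ + _); set V := viol (_ + _).
set S1 := \sum_j _; set S2 := \sum_j _; nra.
Qed.

(** For a large penalty weight [r], the penalized minimizer [u] loses at most [eta / 2] against the
    constrained optimum [y'], and its multipliers bound [f0 u] from above. Adding [tau] to every
    multiplier makes them positive and costs another [eta / 2]. *)
Lemma approx_duality (eta : R) : 0 < eta -> (exists2 y, Y y & vle0 (g y)) ->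
  exists lam : 'rV[R]_p, exists2 y' : 'rV[R]_m,
    [/\ Y y', vle0 (g y') & forall j, 0 < lam 0 j] &
    forall y, Y y -> f0 y' <= f0 y + dotv lam (g y) + eta.
Proof.
move=> eta0 [y0 Yy0 gy0].
pose K := Y `&` [set y | viol y <= 0].
have cK : compact K.
  apply: compact_closedI => //; apply: (@closed_comp _ _ viol [set r | r <= 0]).
    by move=> y _; exact: continuous_viol.
  exact: closed_le.
have K0 : K !=set0 by exists y0; split=> //=; rewrite (viol_eq0 y0).2.
have [y' [Yy' /= gy'] y'min] := continuous_compact_min K0 cK cf.
have {}gy' : vle0 (g y') by apply/viol_eq0/eqP; rewrite eq_le gy' viol_ge0.
(* Points of [Y] with value below [f0 y' - eta / 2] are infeasible, so by compactness their
   violation is bounded away from 0, and a large [r] outweighs their gain in [f0]. *)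
have [r r0 rP] : exists2 r, 0 < r &
    forall y, Y y -> f0 y < f0 y' - eta / 2 -> f0 y' < f0 y + r * viol y.
  pose A := Y `&` [set y | f0 y <= f0 y' - eta / 2].
  have [A0|/set0P/negP/negPn/eqP A0] := pselect (A !=set0); last first.
    exists 1 => // y Yy /ltW fy; have : A y by [].
    by rewrite A0.
  have cA : compact A.
    apply: compact_closedI => //.
    apply: (@closed_comp _ _ f0 [set r | r <= f0 y' - eta / 2]).
      by move=> y _; exact: cf.
    exact: closed_le.
  have [a [Ya fa] amin] := continuous_compact_min A0 cA continuous_viol.
  have [b Yb bmin] := continuous_compact_min (ex_intro Y y0 Yy0) cY cf.
  have va : 0 < viol a.
    rewrite lt_neqAle viol_ge0 andbT eq_sym; apply/negP => /eqP va.
    have := y'min a; rewrite /K /= va => /(_ (conj Ya (lexx _))).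
    by move: fa => /=; lra.
  (* With [b] minimizing [f0] on [Y], this weight makes the penalty on [A] at least
     [f0 y' - f0 b + 1], more than any possible gain. *)
  exists ((f0 y' - f0 b + 1) / viol a).
    by rewrite divr_gt0 // ltr_wpDl // subr_ge0 bmin.
  move=> y Yy /ltW fy; have : viol a <= viol y by exact: amin.
  have := bmin y Yy; have := bmin y' Yy' => H1 H2 H3.
  apply: (@lt_le_trans _ _ (f0 y + (f0 y' - f0 b + 1) / viol a * viol a)).
    by rewrite divfK ?gt_eqF //; lra.
  by rewrite lerD2l ler_wpM2l // divr_ge0 ?(ltW va) //; lra.
have cP : continuous (fun y => f0 y + r * viol y).
  move=> y; apply: (@continuousD R R _ f0 (fun y => r * viol y)); first exact: cf.
  by apply: (@continuousM R _ (fun=> r) viol); [exact: cst_continuous|exact: continuous_viol].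
have [u Yu umin] := continuous_compact_min (ex_intro Y y0 Yy0) cY cP.
(* Otherwise the penalized value at [u] would exceed that at [y'], where the penalty vanishes. *)
have fu : f0 y' - eta / 2 <= f0 u.
  rewrite leNgt; apply/negP => /(rP u Yu).
  by have := umin y' Yy'; rewrite (viol_eq0 y').2 // mulr0 addr0; lra.
have L := penalty_multiplier r0 Yu umin.
(* Here [S] is the minimum over [Y] of the sum of the constraint values, and [tau] is scaled so that
   [tau * S >= - (eta / 2)]. *)
have [b Yb bmin] := @continuous_compact_min _ Y (fun y => \sum_j g y 0 j)
  (ex_intro Y y0 Yy0) cY (continuous_big (@add_continuous _) (fun j _ => @cg j)).
pose S := \sum_j g b 0 j.
pose tau := eta / 2 / (`|S| + 1).
have S1 : 0 < `|S| + 1 by rewrite ltr_wpDl.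
have tau0 : 0 < tau by rewrite !divr_gt0.
exists (\row_j (2 * r * Num.max 0 (g u 0 j) + tau)), y'; first split=> // j.
  rewrite mxE ltr_wpDl // mulr_ge0 // ?mulr_ge0 ?(ltW r0) //.
  by rewrite le_max lexx.
move=> y Yy; have := L y Yy; have := bmin y Yy.
have -> : dotv (\row_j (2 * r * Num.max 0 (g u 0 j) + tau)) (g y) =
    dotv (\row_j (2 * r * Num.max 0 (g u 0 j))) (g y) + tau * \sum_j g y 0 j.
  by rewrite /dotv mulr_sumr -big_split /=; apply: eq_bigr => j _; rewrite !mxE mulrDl.
rewrite -/S => Sy.
have : - (eta / 2) <= tau * \sum_j g y 0 j.
  apply: (@le_trans _ _ (tau * S)); last by rewrite ler_pM2l.
  rewrite lerNl -mulrN (@le_trans _ _ (tau * (`|S| + 1))) //.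
    by rewrite ler_pM2l // ler_wpDr // -normrN ler_norm.
  by rewrite divfK ?gt_eqF.
lra.
Qed.

End Penalty.
End Duality.

(** * Parametric Lipschitz bounds *)

Section Lipschitz.
Variable R : realType.
Set Implicit Arguments. Unset Strict Implicit.

Lemma mx_norm_le (k l : nat) (A : 'M[R]_(k, l)) (a : R) :
  0 <= a -> (forall i j, `|A i j| <= a) -> `|A| <= a.
Proof.
move=> a0 Aa; rewrite [leLHS]/Num.Def.normr /= mx_normrE.
by apply/bigmax_leP; split=> // -[i j] _; exact: Aa.
Qed.

Lemma coord_le_norm (k l : nat) (A : 'M[R]_(k, l)) i j : `|A i j| <= `|A|.
Proof.
rewrite [leRHS]/Num.Def.normr /= mx_normrE.
by apply: (@le_bigmax _ _ _ 0 (fun ij => `|A ij.1 ij.2|) (i, j)).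
Qed.

Lemma is_derive_line (N : nat) (c : 'rV[R]_N -> R) (z w : 'rV[R]_N) (s : R) :
  differentiable c (z + s *: w) ->
  is_derive s 1 (fun t : R => c (z + t *: w)) ('d c (z + s *: w) w).
Proof.
move=> dc.
have E : (fun h : R => h^-1 *:
      (((fun t : R => c (z + t *: w)) \o shift s) (h *: 1) - c (z + s *: w)))
    = (fun h : R => h^-1 *: ((c \o shift (z + s *: w)) (h *: w) - c (z + s *: w))).
  by apply/funext => h /=; rewrite scalerDl addrCA [h%:A]mulr1.
have dw := @diff_derivable _ _ _ c (z + s *: w) w dc.
split; first by rewrite /derivable E.
by rewrite /derive E -deriveE.
Qed.

(** Mean value theorem on the segment from [z] to [z'], which stays in a ball where continuity
    bounds all partial derivatives. *)
Lemma C1_locally_lipschitz (N : nat) (c : 'rV[R]_N -> R) (z0 : 'rV[R]_N) :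
  C1 c -> exists C, exists2 r, 0 < r & forall z z', `|z - z0| < r ->
    `|z' - z0| < r -> `|c z' - c z| <= C * `|z' - z|.
Proof.
move=> [dc pc].
have : \forall z \near z0, forall i, `|partial c i z| < `|partial c i z0| + 1.
  have H i : \forall z \near z0, `|partial c i z| < `|partial c i z0| + 1.
    have pi0 : `|partial c i z0| < `|partial c i z0| + 1 by rewrite ltrDl.
    exact: (cvgr_norm_lt _ (pc i z0) _ pi0).
  exact: (filter_forall (F := nbhs z0) _ H).
move=> /nbhs_normP[r /= r0 rP].
exists (\sum_i (`|partial c i z0| + 1)), r => // z z' zr zr'.
pose w := z' - z.
have lw (s : R) : s \in `[0, 1] -> `|z + s *: w - z0| < r.
  rewrite in_itv /= => /andP[s0 s1].
  have -> : z + s *: w - z0 = (1 - s) *: (z - z0) + s *: (z' - z0).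
    by apply/rowP => i; rewrite !mxE; ring.
  apply: le_lt_trans (ler_normD _ _) _.
  rewrite !normrZ (ger0_norm s0) ger0_norm ?subr_ge0 //.
  have := ler_wpM2l s0 (ltW zr').
  have [->|s1'] := eqVneq s 1; first by rewrite subrr mul0r add0r mul1r.
  have : 0 < 1 - s by rewrite subr_gt0 lt_neqAle s1'.
  move=> s2; have := zr; rewrite -(ltr_pM2l s2); lra.
have dline (s : R) := is_derive_line (@dc (z + s *: w)).
have cline : {within `[0, 1], continuous (fun s => c (z + s *: w))}.
  apply: continuous_subspaceT => s; apply: differentiable_continuous.
  by apply/derivable1_diffP; have [] := dline s.
have [s s01] := MVT_segment ler01 (fun s _ => dline s) cline.
have zw : z + w = z' by rewrite addrC subrK.
rewrite scale1r scale0r addr0 zw subr0 mulr1 => ->.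
rewrite diff_partialE // mulr_suml.
apply: le_trans (ler_norm_sum _ _ _) _; apply: ler_sum => i _.
rewrite normrM mulrC ler_pM // ?coord_le_norm //.
apply/ltW/rP; rewrite /= distrC; exact: lw.
Qed.

Lemma norm_row_mx_le (n m : nat) (a : 'rV[R]_n) (b : 'rV[R]_m) :
  `|row_mx a b| <= Num.max `|a| `|b|.
Proof.
apply: mx_norm_le => [|i j]; first by rewrite le_max normr_ge0.
by case: (split_ordP j) => k ->; rewrite ?row_mxEl ?row_mxEr le_max coord_le_norm ?orbT.
Qed.

Lemma row_mxB (n m : nat) (a a' : 'rV[R]_n) (b b' : 'rV[R]_m) :
  row_mx a b - row_mx a' b' = row_mx (a - a') (b - b').
Proof. by rewrite opp_row_mx add_row_mx. Qed.

Lemma continuous_row_mx (n m : nat) :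
  continuous (fun w : 'rV[R]_n * 'rV[R]_m => row_mx w.1 w.2).
Proof.
move=> w; apply/cvgrPdist_lt => e e0; near=> w'.
rewrite row_mxB (le_lt_trans (norm_row_mx_le _ _)) // gt_max; apply/andP; split.
  by near: w'; apply: (@cvgr_dist_lt _ _ _ _ _ (fun w => w.1) w.1) => //; exact: cvg_fst.
by near: w'; apply: (@cvgr_dist_lt _ _ _ _ _ (fun w => w.2) w.2) => //; exact: cvg_snd.
Unshelve. all: by end_near. Qed.

Lemma near_line_ball (E : normedModType R) (x x0 d : E) (r : R) :
  `|x - x0| < r -> \forall t \near 0^'+, `|x + t *: d - x0| < r.
Proof.
move=> xr; have d1 : 0 < `|d| + 1 by rewrite ltr_wpDl.
near=> t; have t0 : 0 < t by near: t; exact: nbhs_right_gt.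
rewrite addrAC (le_lt_trans (ler_normD _ _)) // normrZ gtr0_norm // -ltrBrDl.
apply: (@le_lt_trans _ _ (t * (`|d| + 1))); first by rewrite ler_pM2l // lerDl.
rewrite -ltr_pdivlMr //; near: t; apply: nbhs_right_lt.
by rewrite divr_gt0 // subr_gt0.
Unshelve. all: by end_near. Qed.

Section Parametric.
Variables (n m : nat) (f : 'rV[R]_n -> 'rV[R]_m -> R).
Hypothesis C1f : C1 (fun z : 'rV[R]_(n + m) => f (lsubmx z) (rsubmx z)).

Lemma continuous_uncurry : continuous (fun w : 'rV[R]_n * 'rV[R]_m => f w.1 w.2).
Proof.
rewrite (_ : (fun _ => _) = (fun z : 'rV[R]_(n + m) => f (lsubmx z) (rsubmx z)) \o
    (fun w : 'rV[R]_n * 'rV[R]_m => row_mx w.1 w.2)); last first.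
  by apply/funext => w /=; rewrite row_mxKl row_mxKr.
move=> w; apply: continuous_comp; first exact: continuous_row_mx.
apply: differentiable_continuous; exact: C1f.1.
Qed.

(** Radius and constant are tied to one parameter [r]: shrinking [r] weakens the claim, so it holds
    for all small [r] and finitely many such bounds share one [r]. *)
Lemma locally_lipschitz_param (x0 : 'rV[R]_n) (y0 : 'rV[R]_m) :
  \forall r \near 0^'+, forall x x' y, `|x - x0| < r -> `|x' - x0| < r ->
    `|y - y0| < r -> `|f x' y - f x y| <= r^-1 * `|x' - x|.
Proof.
have [C [s s0 Cs]] := C1_locally_lipschitz (row_mx x0 y0) C1f.
have C1 : 0 < `|C| + 1 by rewrite ltr_wpDl.
near=> r => x x' y xr xr' yr.
have r0 : 0 < r by near: r; exact: nbhs_right_gt.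
have rs : r <= s by near: r; exact: nbhs_right_le.
have Cr : C <= r^-1.
  rewrite (le_trans (ler_norm _)) // (@le_trans _ _ (`|C| + 1)) ?lerDl //.
  rewrite -[_ + 1]invrK lef_pV2 ?posrE ?invr_gt0 //.
  by near: r; apply: nbhs_right_le; rewrite invr_gt0.
have B (u : 'rV[R]_n) : `|u - x0| < r -> `|row_mx u y - row_mx x0 y0| < s.
  move=> ur; rewrite row_mxB (le_lt_trans (norm_row_mx_le _ _)) // gt_max.
  by rewrite !(lt_le_trans _ rs).
have := Cs _ _ (B _ xr) (B _ xr'); rewrite !row_mxKl !row_mxKr => /le_trans; apply.
rewrite (@le_trans _ _ (r^-1 * `|row_mx x' y - row_mx x y|)) ?ler_wpM2r //.
rewrite ler_pM2l ?invr_gt0 // row_mxB subrr (le_trans (norm_row_mx_le _ _)) //.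
by rewrite ge_max lexx normr0 normr_ge0.
Unshelve. all: by end_near. Qed.

(** The near-covering form of compactness makes the local bounds uniform over [Y]. *)
Lemma compact_lipschitz_param (Y : set 'rV[R]_m) (x0 : 'rV[R]_n) : compact Y ->
  \forall r \near 0^'+, forall y, Y y -> forall x x', `|x - x0| < r ->
    `|x' - x0| < r -> `|f x' y - f x y| <= r^-1 * `|x' - x|.
Proof.
move=> /compact_near_coveringP cY.
apply: (cY R 0^'+ (fun r y => forall x x', `|x - x0| < r ->
    `|x' - x0| < r -> `|f x' y - f x y| <= r^-1 * `|x' - x|)) => y0 _.
near (0 : R)^'+ => s.
have s0 : 0 < s by near: s; exact: nbhs_right_gt.
have sP : forall x x' y, `|x - x0| < s -> `|x' - x0| < s ->
    `|y - y0| < s -> `|f x' y - f x y| <= s^-1 * `|x' - x|.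
  by near: s; exact: locally_lipschitz_param.
have Y0 : \forall y \near y0, `|y - y0| < s.
  by apply/nbhs_normP; exists s => // u /=; rewrite distrC.
near=> y r => x x' xr xr'; have ys : `|y - y0| < s by near: y.
have r0 : 0 < r by near: r; exact: nbhs_right_gt.
have rs : r <= s by near: r; exact: nbhs_right_le.
apply: (le_trans (sP _ _ _ (lt_le_trans xr rs) (lt_le_trans xr' rs) ys)).
by rewrite ler_wpM2r // lef_pV2 ?posrE.
Unshelve. all: by end_near. Qed.

(** The move in [x] costs a Lipschitz term. By convexity the move in [y] gains at least [t] times
    the full-step difference, which is continuous in the base point; the strict bound by [a] absorbs
    its variation. *)
Lemma convex_slope_le (x0 : 'rV[R]_n) (y0 y' : 'rV[R]_m) :
  (forall x, convex_fun_rV (f x)) ->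
  exists C, forall dx a, f x0 y' - f x0 y0 + C * `|dx| < a ->
    slope_le (fun w => f w.1 w.2) (x0, y0) (dx, y' - y0) a.
Proof.
move=> vf; near (0 : R)^'+ => r.
have r0 : 0 < r by near: r; exact: nbhs_right_gt.
have rP : forall x x' y, `|x - x0| < r -> `|x' - x0| < r ->
    `|y - y0| < r -> `|f x' y - f x y| <= r^-1 * `|x' - x|.
  by near: r; exact: locally_lipschitz_param.
exists r^-1 => dx a; rewrite -ltrBrDr => fa.
set dy := y' - y0.
near=> w.
have xr : `|w.1 - x0| < r.
  by near: w; apply: (@cvgr_distC_lt _ _ _ _ _ (fun w => w.1) x0) => //; exact: cvg_fst.
have yr : `|w.2 - y0| < r.
  by near: w; apply: (@cvgr_distC_lt _ _ _ _ _ (fun w => w.2) y0) => //; exact: cvg_snd.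
near=> t => /=.
have t0 : 0 < t by near: t; exact: nbhs_right_gt.
have t1 : t <= 1 by near: t; exact: nbhs_right_le.
have xtr : `|w.1 + t *: dx - x0| < r by near: t; apply: near_line_ball.
have ytr : `|w.2 + t *: dy - y0| < r by near: t; apply: near_line_ball.
have : f w.1 (w.2 + dy) - f w.1 w.2 < a - r^-1 * `|dx|.
  near: w.
  have cc : (fun w : 'rV[R]_n * 'rV[R]_m => f w.1 (w.2 + dy) - f w.1 w.2) @ (x0, y0)
      --> f x0 (y0 + dy) - f x0 y0.
    apply: cvgB; last exact: (@continuous_uncurry (x0, y0)).
    apply: (@cvg_comp _ _ _ (fun w : 'rV[R]_n * 'rV[R]_m => (w.1, w.2 + dy))
        (fun w => f w.1 w.2) _ (nbhs (x0, y0 + dy))).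
      apply: (@cvg_pair _ _ _ (nbhs (x0, y0)) (nbhs x0) (nbhs (y0 + dy))); first exact: cvg_fst.
      by apply: cvgD; [exact: cvg_snd|exact: cvg_cst].
    exact: (@continuous_uncurry (x0, y0 + dy)).
  by apply: (cvgr_lt _ cc); rewrite /dy [y0 + _]addrC subrK.
move=> fw; have := rP _ _ _ xr xtr ytr.
rewrite addrAC subrr add0r normrZ gtr0_norm // => /ler_normlW.
have := vf w.1 (w.2 + dy) w.2 t; rewrite (ltW t0) t1 => /(_ isT).
have -> : t *: (w.2 + dy) + (1 - t) *: w.2 = w.2 + t *: dy.
  by apply/rowP => i; rewrite !mxE; ring.
move: fw; rewrite -(ltr_pM2l t0) mulrCA.
set u1 := f _ _; set u2 := f _ _; set u3 := f _ _; set u4 := f _ _.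
rewrite !mulrBr mulrCA; set e := r^-1 * _; lra.
Unshelve. all: by end_near. Qed.

End Parametric.
End Lipschitz.

(** * The regularized dual value function *)

Section Lagrangian.
Variable R : realType.
Set Implicit Arguments. Unset Strict Implicit.

Lemma convex_sqnorm (N : nat) : convex_fun_rV (@sqnorm R N).
Proof.
move=> a b t /andP[t0 t1]; rewrite /sqnorm /dotv !mulr_sumr -big_split /=.
apply: ler_sum => i _; rewrite !mxE -subr_ge0.
have -> : t * (a 0 i * a 0 i) + (1 - t) * (b 0 i * b 0 i) -
    (t * a 0 i + (1 - t) * b 0 i) * (t * a 0 i + (1 - t) * b 0 i) =
    t * (1 - t) * (a 0 i - b 0 i) ^+ 2 by ring.
by rewrite mulr_ge0 ?sqr_ge0 // mulr_ge0 // subr_ge0.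
Qed.

Lemma continuous_sqnorm (N : nat) : continuous (@sqnorm R N).
Proof. by move=> y; apply: (@cvg_dotv _ _ _ (nbhs y) _ id id); exact: cvg_id. Qed.

Lemma dotvDl (N : nat) (u v w : 'rV[R]_N) : dotv (u + v) w = dotv u w + dotv v w.
Proof. by rewrite /dotv -big_split; apply: eq_bigr => i _; rewrite mxE mulrDl. Qed.

Lemma dotvZl (N : nat) (t : R) (u w : 'rV[R]_N) : dotv (t *: u) w = t * dotv u w.
Proof. by rewrite /dotv mulr_sumr; apply: eq_bigr => i _; rewrite mxE mulrA. Qed.

Lemma dotv_lipschitz (N : nat) (l u v : 'rV[R]_N) (B K : R) :
  (forall j, `|l 0 j| <= B) -> (forall j, `|v 0 j - u 0 j| <= K) ->
  dotv l u - dotv l v <= N%:R * (B * K).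
Proof.
move=> lB uv; rewrite /dotv -sumrB.
have -> : N%:R * (B * K) = \sum_(j < N) (B * K) by rewrite sumr_const card_ord mulr_natl.
apply: ler_sum => j _; rewrite -mulrBr (le_trans (ler_norm _)) // normrM.
by rewrite ler_pM // distrC.
Qed.

Section Value.
Variables (n m p : nat) (f : 'rV[R]_n -> 'rV[R]_m -> R).
Variables (g : 'rV[R]_n -> 'rV[R]_m -> 'rV[R]_p) (Y : set 'rV[R]_m) (mu : R).
Hypothesis C1f : C1 (fun z : 'rV[R]_(n + m) => f (lsubmx z) (rsubmx z)).
Hypothesis C1g :
  forall j, C1 (fun z : 'rV[R]_(n + m) => g (lsubmx z) (rsubmx z) 0 j).
Hypothesis cY : compact Y.
Hypothesis Y0 : Y !=set0.

Definition lagrangian lam x y := mu * sqnorm y + f x y + dotv lam (g x y).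

Lemma continuous_lagrangian : continuous
  (fun u : ('rV[R]_p * 'rV[R]_n) * 'rV[R]_m => lagrangian u.1.1 u.1.2 u.2).
Proof.
move=> u; pose q (u : ('rV[R]_p * 'rV[R]_n) * 'rV[R]_m) := (u.1.2, u.2).
have c1 : (fun u : ('rV[R]_p * 'rV[R]_n) * 'rV[R]_m => u.1) @ u --> u.1 by exact: cvg_fst.
have c2 : (fun u : ('rV[R]_p * 'rV[R]_n) * 'rV[R]_m => u.2) @ u --> u.2 by exact: cvg_snd.
have c11 : (fun u : ('rV[R]_p * 'rV[R]_n) * 'rV[R]_m => u.1.1) @ u --> u.1.1.
  by apply: (cvg_comp _ _ c1); exact: cvg_fst.
have c12 : (fun u : ('rV[R]_p * 'rV[R]_n) * 'rV[R]_m => u.1.2) @ u --> u.1.2.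
  by apply: (cvg_comp _ _ c1); exact: cvg_snd.
have cq : q @ u --> nbhs (q u).
  exact: (@cvg_pair _ _ _ (nbhs u) (nbhs u.1.2) (nbhs u.2)).
apply: cvgD; first apply: cvgD.
- apply: cvgM; first exact: cvg_cst.
  by apply: (cvg_comp _ _ c2); exact: continuous_sqnorm.
- exact: (cvg_comp _ _ cq (@continuous_uncurry _ _ _ _ C1f (q u))).
rewrite /dotv; apply: cvg_big => [|j _]; first exact: add_continuous.
apply: cvgM.
  exact: (cvg_comp _ _ c11 (@coord_continuous _ _ _ _ _ u.1.1)).
exact: (cvg_comp _ _ cq (@continuous_uncurry _ _ _ (fun x y => g x y 0 j) (C1g j) (q u))).
Qed.

Lemma continuous_lagrangian_y lam x : continuous (lagrangian lam x).
Proof.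
move=> y; pose k (y : 'rV[R]_m) := ((lam, x), y).
have ck : k @ y --> nbhs (k y).
  apply: (@cvg_pair _ _ _ (nbhs y) (nbhs (lam, x)) (nbhs y)); last exact: cvg_id.
  exact: cvg_cst.
exact: (cvg_comp _ _ ck (@continuous_lagrangian (k y))).
Qed.

Local Notation h := (hmu f g Y mu).

Lemma hmu_le lam x y : Y y -> h lam x <= lagrangian lam x y.
Proof.
move=> Yy; apply: ge_inf; last by exists y.
(* A minimizer supplies the lower bound that makes [inf] a genuine infimum. *)
have [b Yb bmin] := continuous_compact_min Y0 cY (continuous_lagrangian_y (lam := lam) (x := x)).
by exists (lagrangian lam x b) => _ [y' Yy' <-]; exact: bmin.
Qed.

Lemma le_hmu lam x a : (forall y, Y y -> a <= lagrangian lam x y) -> a <= h lam x.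
Proof.
move=> aY; apply: lb_le_inf; first by case: Y0 => y Yy; exists (lagrangian lam x y); exists y.
by move=> _ [y Yy <-]; exact: aY.
Qed.

(** By compactness of [Y], nearby parameters give Lagrangians uniformly [e]-close on [Y], hence
    [e]-close infima. *)
Lemma continuous_hmu : continuous (fun w : 'rV[R]_p * 'rV[R]_n => h w.1 w.2).
Proof.
move=> w0; apply/cvgrPdist_le => e e0.
have : \forall w \near w0, Y `<=`
    (fun y => `|lagrangian w0.1 w0.2 y - lagrangian w.1 w.2 y| < e).
  apply: ((iffLR (compact_near_coveringP Y) cY) _ (nbhs w0)
    (fun w y => `|lagrangian w0.1 w0.2 y - lagrangian w.1 w.2 y| < e)) => y _.
  have e2 : 0 < e / 2 by rewrite divr_gt0.
  have := cvgr_dist_lt _ _ (@continuous_lagrangian (w0, y)) _ e2.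
  move=> [[A B] /= [A0 B0] AB]; exists (B, A) => // -[y' w] /= [By' Aw].
  have := AB (w, y') (conj Aw By'); have := AB (w0, y') (conj (nbhs_singleton A0) By').
  rewrite /= ![`|lagrangian w0.1 w0.2 y - _|]distrC => H1 H2.
  have := ler_distD (lagrangian w0.1 w0.2 y) (lagrangian w0.1 w0.2 y') (lagrangian w.1 w.2 y').
  rewrite [`|lagrangian w0.1 w0.2 y - _|]distrC; lra.
move=> H; near=> w.
have wY : forall y, Y y -> `|lagrangian w0.1 w0.2 y - lagrangian w.1 w.2 y| < e.
  by near: w; exact: H.
rewrite ler_norml; apply/andP; split.
  rewrite lerBrDr addrC; apply: le_hmu => y Yy.
  have := wY y Yy; rewrite ltr_norml => /andP[+ _].
  have := hmu_le w.1 w.2 Yy; lra.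
rewrite lerBlDr -lerBlDl; apply: le_hmu => y Yy.
have := wY y Yy; rewrite ltr_norml => /andP[_].
have := hmu_le (w0.1) (w0.2) Yy; lra.
Unshelve. all: by end_near. Qed.

(* [h] is concave in the multiplier, hence bounded below along the segment from
   [lam0] to [lam']; moving [x] costs at most a Lipschitz term. *)
Lemma hmu_slope_le (lam0 lam' : 'rV[R]_p) (x0 : 'rV[R]_n) :
  exists C, forall dx a, h lam0 x0 - h lam' x0 + C * `|dx| < a ->
    slope_le (fun w : 'rV[R]_p * 'rV[R]_n => - h w.1 w.2)
      (lam0, x0) (lam' - lam0, dx) a.
Proof.
near (0 : R)^'+ => r.
have r0 : 0 < r by near: r; exact: nbhs_right_gt.
have fP : forall y, Y y -> forall x x', `|x - x0| < r -> `|x' - x0| < r ->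
    `|f x' y - f x y| <= r^-1 * `|x' - x|.
  by near: r; exact: compact_lipschitz_param.
have gP : forall j y, Y y -> forall x x', `|x - x0| < r -> `|x' - x0| < r ->
    `|g x' y 0 j - g x y 0 j| <= r^-1 * `|x' - x|.
  near: r; apply: filter_forall => j.
  exact: (@compact_lipschitz_param R n m (fun x y => g x y 0 j) (C1g j) Y x0 cY).
(* [B] bounds the coordinates of all multipliers within [r] of [lam0]; [C] adds the Lipschitz cost
   of [f] to that of the [p] terms of [dotv lam g]. *)
pose B := `|lam0| + r.
pose C := r^-1 + p%:R * (B * r^-1).
exists C => dx a; rewrite -ltrBrDr => ha.
set dl := lam' - lam0.
near=> w.
have xr : `|w.2 - x0| < r.
  by near: w; apply: (@cvgr_distC_lt _ _ _ _ _ (fun w => w.2) x0) => //; exact: cvg_snd.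
have lr : `|w.1 - lam0| < r.
  by near: w; apply: (@cvgr_distC_lt _ _ _ _ _ (fun w => w.1) lam0) => //; exact: cvg_fst.
have hw : h w.1 w.2 - h (w.1 + dl) w.2 < a - C * `|dx|.
  near: w.
  have cc : (fun w : 'rV[R]_p * 'rV[R]_n => h w.1 w.2 - h (w.1 + dl) w.2) @ (lam0, x0)
      --> h lam0 x0 - h (lam0 + dl) x0.
    apply: cvgB; first exact: (@continuous_hmu (lam0, x0)).
    apply: (@cvg_comp _ _ _ (fun w : 'rV[R]_p * 'rV[R]_n => (w.1 + dl, w.2))
        (fun w => h w.1 w.2) _ (nbhs (lam0 + dl, x0))).
      apply: (@cvg_pair _ _ _ (nbhs (lam0, x0)) (nbhs (lam0 + dl)) (nbhs x0)).
        by apply: cvgD; [exact: cvg_fst|exact: cvg_cst].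
      exact: cvg_snd.
    exact: (@continuous_hmu (lam0 + dl, x0)).
  by apply: (cvgr_lt _ cc); rewrite /dl [lam0 + _]addrC subrK.
near=> t => /=.
have t0 : 0 < t by near: t; exact: nbhs_right_gt.
have t1 : t <= 1 by near: t; exact: nbhs_right_le.
have xtr : `|w.2 + t *: dx - x0| < r by near: t; apply: near_line_ball.
have ltr : `|w.1 + t *: dl - lam0| < r by near: t; apply: near_line_ball.
suff : h w.1 w.2 - t * a <= h (w.1 + t *: dl) (w.2 + t *: dx) by lra.
apply: le_hmu => y Yy.
have lB j : `|(w.1 + t *: dl) 0 j| <= B.
  rewrite (le_trans (coord_le_norm _ _ _)) // /B -lerBlDl.
  by rewrite (le_trans _ (ltW ltr)) // lerB_dist.
have xx : `|w.2 + t *: dx - w.2| = t * `|dx|.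
  by rewrite addrAC subrr add0r normrZ gtr0_norm.
have Hf := le_trans (ler_norm _) (fP y Yy _ _ xtr xr).
have Hg := dotv_lipschitz lB (fun j => gP j y Yy _ _ xr xtr).
move: Hf Hg; rewrite distrC !xx => Hf Hg.
have H1 : (1 - t) * h w.1 w.2 <= (1 - t) * lagrangian w.1 w.2 y.
  by rewrite ler_wpM2l ?subr_ge0 // hmu_le.
have H2 : t * h (w.1 + dl) w.2 <= t * lagrangian (w.1 + dl) w.2 y.
  by rewrite ler_pM2l // hmu_le.
(* Concavity of [h] enters here: the Lagrangian is affine in the multiplier, and [h] bounds both
   endpoint Lagrangians from below. *)
have L : mu * sqnorm y + f w.2 y + dotv (w.1 + t *: dl) (g w.2 y) =
    (1 - t) * lagrangian w.1 w.2 y + t * lagrangian (w.1 + dl) w.2 y.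
  by rewrite /lagrangian !(dotvDl w.1) dotvZl; ring.
move: hw; rewrite -(ltr_pM2l t0) => hw.
have E : t * (a - C * `|dx|) =
    t * a - r^-1 * (t * `|dx|) - p%:R * (B * (r^-1 * (t * `|dx|))).
  by rewrite /C; ring.
rewrite E mulrBr in hw; rewrite /lagrangian.
move: L hw H1 H2 Hf Hg; set L1 := lagrangian _ _ _; set L2 := lagrangian _ _ _.
set e1 := r^-1 * _; set e2 := p%:R * _.
set h1 := hmu _ _ _ _ _ _; set h2 := hmu _ _ _ _ _ _.
set s := mu * _; set f1 := f _ _; set f2 := f _ _.
set g1 := dotv _ _; set g2 := dotv _ _; lra.
Unshelve. all: by end_near. Qed.

End Value.
End Lagrangian.

(** * The constraint qualification *)

Section ConstraintQualification.
Variable R : realType.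
Set Implicit Arguments. Unset Strict Implicit.

Lemma slope_leDc (E : normedModType R) (c : E -> R) (z0 d : E) (a b : R) :
  slope_le c z0 d a -> slope_le (fun z => c z + b) z0 d a.
Proof.
move=> s; near=> z.
have sz : \forall t \near 0^'+, c (z + t *: d) <= c z + t * a by near: z.
by near=> t; rewrite addrAC lerD2r; near: t.
Unshelve. all: by end_near. Qed.

Lemma near_small_scale (E : normedModType R) (C e : R) (v : E) :
  0 < e -> \forall t \near 0^'+, C * `|t *: v| < e.
Proof.
move=> e0; have d1 : 0 < `|C * `|v| | + 1 by rewrite ltr_wpDl.
near=> t; have t0 : 0 < t by near: t; exact: nbhs_right_gt.
rewrite normrZ gtr0_norm // mulrCA (le_lt_trans (ler_norm _)) //.
rewrite normrM gtr0_norm // (@lt_le_trans _ _ (t * (`|C * `|v| | + 1))) //.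
  by rewrite ltr_pM2l // ltrDl.
by rewrite -ler_pdivlMr //; near: t; apply: nbhs_right_le; rewrite divr_gt0.
Unshelve. all: by end_near. Qed.

Lemma MFCQ_of_slope (I : finType) (N : nat) (c : I -> 'rV[R]_N -> R) (z d : 'rV[R]_N) :
  (forall i, c i z = 0 -> exists2 a, a < 0 & slope_le (c i) z d a) -> MFCQ c z.
Proof.
move=> H; exists d => i ci v lv; have [a a0 s] := H i ci.
exact: le_lt_trans (limiting_subgrad_slope s lv) a0.
Qed.

Section Projections.
Variables n m p : nat.
Implicit Types z d : 'rV[R]_(n + m + p).

Lemma zxD z d t : zx (z + t *: d) = zx z + t *: zx d.
Proof. by rewrite /zx !linearD !linearZ. Qed.

Lemma zyD z d t : zy (z + t *: d) = zy z + t *: zy d.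
Proof. by rewrite /zy !linearD !linearZ. Qed.

Lemma zlD z d t : zl (z + t *: d) = zl z + t *: zl d.
Proof. by rewrite /zl !linearD !linearZ. Qed.

Lemma continuous_zx : continuous (@zx R n m p).
Proof. by move=> z; apply: continuous_comp; apply: continuous_lsubmx. Qed.

Lemma continuous_zy : continuous (@zy R n m p).
Proof.
by move=> z; apply: continuous_comp; [apply: continuous_lsubmx|apply: continuous_rsubmx].
Qed.

Lemma continuous_zl : continuous (@zl R n m p).
Proof. exact: continuous_rsubmx. Qed.

Lemma slope_le_zx (c : 'rV[R]_n -> R) z d a :
  slope_le c (zx z) (zx d) a -> slope_le (fun z => c (zx z)) z d a.
Proof. by apply: slope_le_comp; [exact: continuous_zx|move=> z' t; exact: zxD]. Qed.

Lemma slope_le_zxy (c : 'rV[R]_n * 'rV[R]_m -> R) z d a :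
  slope_le c (zx z, zy z) (zx d, zy d) a -> slope_le (fun z => c (zx z, zy z)) z d a.
Proof.
apply: (slope_le_comp (l := fun z => (zx z, zy z))) => [|z' t]; last by rewrite zxD zyD.
by apply: (@cvg_pair _ _ _ (nbhs z) (nbhs (zx z)) (nbhs (zy z)));
  [exact: continuous_zx|exact: continuous_zy].
Qed.

Lemma slope_le_zlx (c : 'rV[R]_p * 'rV[R]_n -> R) z d a :
  slope_le c (zl z, zx z) (zl d, zx d) a -> slope_le (fun z => c (zl z, zx z)) z d a.
Proof.
apply: (slope_le_comp (l := fun z => (zl z, zx z))) => [|z' t]; last by rewrite zxD zlD.
by apply: (@cvg_pair _ _ _ (nbhs z) (nbhs (zl z)) (nbhs (zx z)));
  [exact: continuous_zl|exact: continuous_zx].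
Qed.

End Projections.
End ConstraintQualification.

Theorem theorem3 (R : realType) (n m p q : nat)
  (F f : 'rV[R]_n -> 'rV[R]_m -> R) (g : 'rV[R]_n -> 'rV[R]_m -> 'rV[R]_p)
  (G : 'rV[R]_n -> 'rV[R]_q) (Y : set 'rV[R]_m) (eps mu : R) :
  let X := [set x | vle0 (G x)] in
  (* (A1) *)
  (forall x, convex_fun_rV (f x)) ->
  (forall x (j : 'I_p), convex_fun_rV (fun y => g x y 0 j)) ->
  C2_2 f -> C2vec_2 g ->
  (* (A2) *)
  compact Y -> convex_set_rV Y ->
  [set y | exists2 x, X x & vle0 (g x y)] `<=` interior Y ->
  (* (A3) *)
  C2_2 F -> C2vec G ->
  (* (R1) *)
  (forall x, X x -> exists y, vlt0 (g x y)) ->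
  (* (R2) *)
  compact X -> X !=set0 ->
  (forall x, X x -> MFCQ (fun k : 'I_q => fun x' => G x' 0 k) x) ->
  0 < eps -> 0 <= mu ->
  forall z, DBP_feas f g G Y eps mu z -> MFCQ (DBP_constr f g G Y eps mu) z.
Proof.
move=> X vf vg C2f C2g cY vY YX _ C2G R1 _ _ GX eps0 mu0 z zfeas.
have C1f := C2f.1.
have C1g j : C1 (fun z : 'rV[R]_(n + m) => g (lsubmx z) (rsubmx z) 0 j) := (C2g j).1.
pose x0 := zx z; pose y0 := zy z; pose l0 := zl z.
have Xx0 : X x0 by move=> k; exact: (zfeas (inl (inl (inl k)))).
have [dG dGP] := GX x0 Xx0.
have [ys ysP] := R1 x0 Xx0.
have gys : vle0 (g x0 ys) by move=> j; exact: ltW (ysP j).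
have Yys : Y ys by apply: interior_subset; apply: YX; exists x0.
have Y0 : Y !=set0 by exists ys.
have cy (u : 'rV[R]_n -> 'rV[R]_m -> R) :
    C1 (fun z : 'rV[R]_(n + m) => u (lsubmx z) (rsubmx z)) -> continuous (u x0).
  move=> C1u y; have cp : (fun y : 'rV[R]_m => (x0, y)) @ y --> nbhs (x0, y).
    by apply: (@cvg_pair _ _ _ (nbhs y) (nbhs x0) (nbhs y)); [exact: cvg_cst|exact: cvg_id].
  exact: (cvg_comp _ _ cp (@continuous_uncurry _ _ _ _ C1u (x0, y))).
have cf0 : continuous (fun y => mu * sqnorm y + f x0 y).
  move=> y; apply: (@continuousD R R _ (fun y => mu * sqnorm y) (f x0)); last exact: cy.
  apply: (@continuousM R _ (fun=> mu) (@sqnorm R m)); first exact: cst_continuous.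
  exact: continuous_sqnorm.
have vf0 : convex_fun_rV (fun y => mu * sqnorm y + f x0 y).
  move=> a b t t01; have := vf x0 a b t t01.
  have := ler_wpM2l mu0 (@convex_sqnorm R m a b t t01); lra.
have cg0 j : continuous (fun y => g x0 y 0 j).
  exact: (cy (fun x y => g x y 0 j) (C1g j)).
have e2 : 0 < eps / 2 by rewrite divr_gt0.
have [l' [y' [Yy' gy' l'0] dual]] :=
  approx_duality cY vY cf0 vf0 cg0 (vg x0) e2 (ex_intro2 _ _ ys Yys gys).
have fh : f x0 y' <= hmu f g Y mu l' x0 + eps / 2.
  rewrite -lerBlDr; apply: le_hmu => // y Yy; have := dual y Yy.
  have : 0 <= mu * sqnorm y'.
    by rewrite mulr_ge0 // /sqnorm /dotv sumr_ge0 // => i _; rewrite -expr2 sqr_ge0.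
  by rewrite /lagrangian; lra.
have [Cf CfP] := convex_slope_le C1f x0 y0 y' vf.
have /choice[Cg CgP] j := convex_slope_le (C1g j) x0 y0 y' (fun x => vg x j).
have [Ch ChP] := hmu_slope_le mu C1f C1g cY Y0 l0 l' x0.
(* The constants [Cf], [Cg], [Ch] do not depend on the step in [x], so [s] can be chosen after
   them. *)
near (0 : R)^'+ => s.
have s0 : 0 < s by near: s; exact: nbhs_right_gt.
have sf : Cf * `|s *: dG| < eps / 8.
  by near: s; apply: near_small_scale; rewrite divr_gt0.
have sh : Ch * `|s *: dG| < eps / 8.
  by near: s; apply: near_small_scale; rewrite divr_gt0.
have sg : forall j, Cg j * `|s *: dG| < eps / 2.
  by near: s; apply: filter_forall => j; exact: near_small_scale.
pose d := row_mx (row_mx (s *: dG) (y' - y0)) (l' - l0).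
have dx : zx d = s *: dG by rewrite /zx /d !row_mxKl.
have dy : zy d = y' - y0 by rewrite /zy /d row_mxKl row_mxKr.
have dl : zl d = l' - l0 by rewrite /zl /d row_mxKr.
apply: (@MFCQ_of_slope _ _ _ _ _ d) => -[[[k|j]|j]|[]] /= act.
- have dk := (C2G k).1; have ddk := dk.1 x0.
  have neg : 'd (fun x => G x 0 k) x0 (s *: dG) < 0.
    rewrite linearZ /= pmulr_rlt0 // -dotv_grad //.
    by apply: (dGP k act); exact: limiting_subgrad_grad.
  exists ('d (fun x => G x 0 k) x0 (s *: dG) / 2); first lra.
  apply: (@slope_le_zx _ _ _ _ (fun x => G x 0 k)).
  by rewrite dx; apply: C1_slope_le => //; lra.
(* Activity means [g x0 y0 0 j = eps], while [g x0 y' 0 j <= 0]: the slope is below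
   [- eps + eps / 2]. *)
- exists (- (eps / 4)); first lra.
  apply: slope_leDc.
  apply: (@slope_le_zxy _ _ _ _ (fun w => g w.1 w.2 0 j)).
  rewrite dx dy; apply: CgP.
  have := gy' j; have := sg j; move: act; rewrite -/x0 -/y0; lra.
(* An active sign constraint has [l0 0 j = 0], so this coordinate grows at the positive rate
   [l' 0 j]. *)
- exists (- (l' 0 j)); first by rewrite oppr_lt0.
  have coordD (u v : 'rV[R]_p) t : (u + t *: v) 0 j = u 0 j + t * v 0 j.
    by rewrite !mxE.
  have dj : zl d 0 j = l' 0 j - l0 0 j.
    by rewrite dl -[- l0]scaleN1r coordD mulN1r.
  have l00 : l0 0 j = 0 by rewrite -[LHS]opprK act oppr0.
  near=> w; near=> t; rewrite /= zlD coordD dj l00 subr0; lra.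
(* Activity puts the gap [f - h] at [eps], and it is at most [eps / 2] at [(y', l')]. The drop of
   [eps / 2] survives the two Lipschitz costs, each below [eps / 8]. *)
exists (- (eps / 16)); first lra.
apply: slope_leDc.
(* The slope budget is split: [f] receives its own change plus [eps / 8], and [- h] the
   remainder. *)
rewrite (_ : - (eps / 16) = (f x0 y' - f x0 y0 + eps / 8) +
  (- (eps / 16) - (f x0 y' - f x0 y0 + eps / 8))); last by ring.
apply: slope_leD.
  apply: (@slope_le_zxy _ _ _ _ (fun w => f w.1 w.2)).
  by rewrite dx dy; apply: CfP; lra.
apply: (@slope_le_zlx _ _ _ _ (fun w => - hmu f g Y mu w.1 w.2)).
rewrite dx dl; apply: ChP; move: act; rewrite -/x0 -/y0 -/l0.
move: sf sh fh; lra.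
Unshelve. all: by end_near. Qed.
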